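(* Let $r,n\ge 1$ and let $\mathsf{F}$ be an $r$-fan of Dyck paths of length $n$. Then $$\mathsf{G}_F(\mathsf{F})=\mathsf{M}_F(\mathsf{F}),$$ i.e. the symmetric matrix obtained from the filling of the triangular growth diagram of $\mathsf{F}$ (Burge rules) coincides with the filling of the promotion matrix of $\mathsf{F}$.
   Context: Partitions with at most $r$ parts are identified with weakly decreasing $r$-tuples of nonnegative integers; $\emptyset=(0,\dots,0)$. For $x\in\mathbb{Z}^r$, $\mathrm{dom}(x)$ is obtained by sorting $|x_1|,\dots,|x_r|$ into weakly decreasing order. $(\mu\cap\nu)_i=\min\{\mu_i,\nu_i\}$. An $r$-fan of Dyck paths of length $n$ is a sequence $\mathsf{F}=(\emptyset=\mu^0,\mu^1,\dots,\mu^n=\emptyset)$ of partitions with at most $r$ parts such that each $\mu^{i+1}-\mu^i$ lies in $\{\pm1\}^r$. Promotion. For $T=(\emptyset=\mu^0,\dots,\mu^n=\emptyset)$ let $\mathsf{pr}(T)=(\hat\mu^0,\dots,\hat\mu^n)$ with $\hat\mu^0=\emptyset$, $\hat\mu^j=\mathrm{dom}(\hat\mu^{j-1}+\mu^{j+1}-\mu^j)$ for $1\le j\le n-1$, and $\hat\mu^n=\emptyset$. Matrix $\mathsf{M}_F(\mathsf{F})$. Let $T_i=\mathsf{pr}^i(\mathsf{F})=(T_i^0,\dots,T_i^n)$. $\mathsf{M}_F(\mathsf{F})=(m_{i,j})_{1\le i,j\le n}$ has $m_{i,i}=0$, and for $1\le i\le n$, $1\le d\le n-1$ and $j\in\{1,\dots,n\}$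 with $j\equiv i+d \pmod n$, $m_{i,j}$ is the number of negative entries of $\kappa+\nu-\lambda$, where $\lambda=T_{i-1}^{d}$, $\nu=T_{i-1}^{d+1}$, $\kappa=T_i^{d-1}$. Matrix $\mathsf{G}_F(\mathsf{F})$. Consider lattice points $(x,y)$ with $x,y\ge0$, $x+y\le n$, and unit cells with north-east corner $(x,y)$, where $x,y\ge1$, $x+y\le n$. For such a cell let $\alpha,\beta,\gamma,\delta$ be the partitions labelling its corners $(x-1,y)$, $(x,y)$, $(x-1,y-1)$, $(x,y-1)$ respectively, and $m$ its filling. Label $(x,n-x)$ by $\mu^x$ ($0\le x\le n$) and $(x,n-1-x)$ by $\mu^x\cap\mu^{x+1}$ ($0\le x\le n-1$). All other labels and all fillings are obtained by repeatedly applying the Burge backward rules, which compute $\gamma$ and $m$ from $\alpha,\beta,\delta$: (B0) set $i:=\max\{j:\beta_j>0\}$ and $\mathrm{CARRY}:=0$ (if $\beta=\emptyset$ then $\gamma=\emptyset$, $m=0$); (B1) set $\gamma_i:=\min\{\delta_i,\alpha_i\}-\min\{\mathbb{1}_{\beta_i=\delta_i=\alpha_i},\mathrm{CARRY}\}$; (B2) set $\mathrm{CARRY}:=\mathrm{CARRY}-\min\{\mathbb{1}_{\beta_i=\delta_i=\alpha_i},\mathrm{CARRY}\}+\beta_i-\max\{\delta_i,\alpha_i\}$ and $i:=i-1$; if $i=0$ stop and return $\gamma$ and $m=\mathrm{CARRY}$; otherwise go to (B1). Here $\mathbb{1}_A$ is $1$ if $A$ is true and $0$ otherwise. $\mathsf{G}_F(\mathsf{F})$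 is the symmetric $n\times n$ matrix with zero diagonal whose $(i,j)$ entry, for $1\le j<i\le n$, is the filling of the cell with north-east corner $(j,n+1-i)$. *)

(* Defs.v *)
From HB Require Import structures.
From mathcomp Require Import all_boot all_order all_algebra.
Set Implicit Arguments.
Unset Strict Implicit.
Unset Printing Implicit Defensive.
Import Order.TTheory GRing.Theory Num.Theory.
Local Open Scope ring_scope.

(* Elements of Z^r are row vectors 'rV[int]_r; a partition with at most r parts
   is such a vector satisfying [is_partition], and the empty partition is 0.
   Mathematical indices 1..r and 1..n become ordinals 0..r-1 and 0..n-1. *)

Definition is_partition (r : nat) (mu : 'rV[int]_r) : Prop :=
  (forall i : 'I_r, 0 <= mu 0 i) /\
  (forall i j : 'I_r, (i <= j)%N -> mu 0 j <= mu 0 i).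

Definition dom (r : nat) (x : 'rV[int]_r) : 'rV[int]_r :=
  \row_i (sort >=%R [seq `|x 0 k| | k <- enum 'I_r])`_i.

Definition cap (r : nat) (mu nu : 'rV[int]_r) : 'rV[int]_r :=
  \row_i Num.min (mu 0 i) (nu 0 i).

(* In a sequence F = (mu^0, ..., mu^n), the entry mu^i is F`_i. *)
Definition is_fan (r n : nat) (F : n.+1.-tuple 'rV[int]_r) : Prop :=
  [/\ F`_0 = 0,
      F`_n = 0,
      forall i : nat, (i <= n)%N -> is_partition F`_i
    & forall i : nat, (i < n)%N -> forall k : 'I_r,
        (F`_i.+1 - F`_i) 0 k = 1 \/ (F`_i.+1 - F`_i) 0 k = -1].

Fixpoint pr_entry (r n : nat) (T : n.+1.-tuple 'rV[int]_r) (j : nat) :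
    'rV[int]_r :=
  if j is j'.+1 then dom (pr_entry T j' + T`_j.+1 - T`_j) else 0.

Definition pr (r n : nat) (T : n.+1.-tuple 'rV[int]_r) :
    n.+1.-tuple 'rV[int]_r :=
  [tuple if (j < n)%N then pr_entry T j else 0 | j < n.+1].

Definition nb_neg (r : nat) (x : 'rV[int]_r) : nat := #|[set k | x 0 k < 0]|.

(* For i != j in 'I_n, d := (j + n - i) %% n is the unique d in 1..n-1 with
   j = i + d mod n.  The ordinal i stands for the mathematical index i + 1, so
   lambda and nu are read in pr^i(F) and kappa in pr^(i+1)(F). *)
Definition promotion_matrix (r n : nat) (F : n.+1.-tuple 'rV[int]_r) :
    'M[int]_n :=
  \matrix_(i, j)
    if i == j then 0 else
    let d := ((j + n - i) %% n)%N in
    let lambda := (iter i (@pr r n) F)`_d in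
    let nu := (iter i (@pr r n) F)`_d.+1 in
    let kappa := (iter i.+1 (@pr r n) F)`_d.-1 in
    (nb_neg (kappa + nu - lambda))%:Z.

(* Burge backward rules.  The state is (gamma, CARRY); the loop runs downwards
   from the last nonzero part of beta, and the parts of gamma it does not reach
   are 0. *)
Definition burge_step (r : nat) (alpha beta delta : 'rV[int]_r)
    (s : 'rV[int]_r * int) (i : 'I_r) : 'rV[int]_r * int :=
  let: (gamma, carry) := s in
  let eq3 := (beta 0 i == delta 0 i) && (delta 0 i == alpha 0 i) in
  let e := Num.min (if eq3 then 1 else 0) carry in
  (\row_k (if k == i then Num.min (delta 0 i) (alpha 0 i) - e else gamma 0 k),
   carry - e + beta 0 i - Num.max (delta 0 i) (alpha 0 i)).

Definition nb_parts (r : nat) (beta : 'rV[int]_r) : nat :=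
  (\max_(j < r | (0 < beta ord0 j)%R) j.+1)%N.

Definition burge (r : nat) (alpha beta delta : 'rV[int]_r) :
    'rV[int]_r * int :=
  foldl (burge_step alpha beta delta) (0, 0)
        (rev [seq i : 'I_r <- enum 'I_r | (i < nb_parts beta)%N]).

(* [level F k x] is the label of the lattice point (x, n - k - x).  For k >= 2
   it is the south-west corner of the cell whose corners alpha, beta, delta
   are (x, n - k - x + 1), (x + 1, n - k - x + 1), (x + 1, n - k - x). *)
Fixpoint level (r n : nat) (F : n.+1.-tuple 'rV[int]_r) (k x : nat) :
    'rV[int]_r :=
  match k with
  | 0 => F`_x
  | 1 => cap F`_x F`_x.+1
  | (k'.+1 as k1).+1 =>
      (burge (level F k1 x) (level F k' x.+1) (level F k1 x.+1)).1
  end.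

Definition label (r n : nat) (F : n.+1.-tuple 'rV[int]_r) (x y : nat) :
    'rV[int]_r :=
  level F (n - (x + y)) x.

(* Filling of the cell with north-east corner (x, y), x, y >= 1, x + y <= n. *)
Definition filling (r n : nat) (F : n.+1.-tuple 'rV[int]_r) (x y : nat) : int :=
  (burge (label F x.-1 y) (label F x y) (label F x y.-1)).2.

(* With mathematical indices i + 1 > j + 1, the cell (j + 1, n + 1 - (i + 1)). *)
Definition growth_matrix (r n : nat) (F : n.+1.-tuple 'rV[int]_r) : 'M[int]_n :=
  \matrix_(i, j)
    if (j < i)%N then filling F j.+1 (n - i)
    else if (i < j)%N then filling F i.+1 (n - j)
    else 0.

(* Main.v *)
Require Import Defs.
From mathcomp Require Import all_boot all_order all_algebra.
From mathcomp Require Import zify.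
Set Implicit Arguments.
Unset Strict Implicit.
Unset Printing Implicit Defensive.
Import Order.TTheory GRing.Theory Num.Theory.
Local Open Scope ring_scope.

(** A partition [la] is encoded by its truncated sums
    [X_w(la) = \sum_k min(la_k, w)], which increase with [w] by the column
    lengths [N_w(la) = #{k | la_k >= w}].  In these coordinates every local rule
    of the theorem becomes piecewise linear.

    The Burge backward rule becomes the tropical octahedron recurrence
      [X_w(ga) + X_w(be) = max(X_w(al) + X_w(de), X_(w-1)(ga) + X_(w+1)(be))],
    with filling [|be| + |ga| - |al| - |de|] ([burge_octa], [burge_filling]).
    The local rule [mu = dom(ka + nu - la)] of promotion becomes a toggle of
    column lengths ([dom_colht]).

    Promotion rotates the growth matrix by one step ([growth_pr]).  To see this,
    superpose the triangle of [F] and the triangle of [pr F], shifted so that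
    their diagonals agree: the first loses its column 1, the second its bottom
    row, and the fillings of the common region have to be compared.  Between
    them lies a third, middle layer, to be thought of as the growth diagram of
    the common region alone; it is built directly as a family of integer
    sequences obeying the octahedron recurrence ([middle]).  Each of the two
    triangles is linked to the middle layer by two further three-term relations:
    [slide] along one direction of edges and [insertion], whose constant is the
    entry that the middle layer has lost, along the other.  They hold along the
    diagonal because of the toggle rule ([corner]), and they propagate through
    the whole triangle because the three recurrences are consistent around a
    cube ([cube_consistency]).  Reading them for large [w] shows that the common
    cells have the same filling ([filling_shift]), and that both the lost column
    of [F] and the lost row of [pr F] are filled with the numbers of negative
    entries of [ka + nu - la] in the first promotion ([filling_first_column],
    [filling_last_row]).

    Hence the first row of the growth matrix is the first row of the promotion
    matrix.  As row [i] of the promotion matrix is the rotated first row of that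
    of [pr^i F], iterating the rotation gives the equality of all rows. *)

(** * Three-term recurrences on integer sequences *)

(** The octahedron recurrence of a cell with corners [al] (north-west), [be]
    (north-east), [de] (south-east) and [ga] (south-west). *)
Definition octa (al be de ga : nat -> int) : Prop := forall w,
  ga w.+1 + be w.+1 = Num.max (al w.+1 + de w.+1) (ga w + be w.+2).

(** The relation satisfied by the truncated sums of partitions
    [a <= b, b' <= c] when [b'] is the Bender-Knuth reflection of [b] between
    [a] and [c]. *)
Definition slide (a b b' c : nat -> int) : Prop := forall w,
  b w.+1 + b' w.+1 = Num.max (c w.+2 + a w) (a w.+1 + c w.+1).

(** The relation satisfied by the truncated sums of the corners of a cell with
    filling [v] in a growth diagram for the RSK rule on column lengths, where
    [R] is the largest corner, [D] the smallest one, and [A], [B] the others. *)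
Definition insertion (R A B D : nat -> int) (v : int) : Prop := forall w,
  R w.+1 + D w = v + Num.max (A w.+1 + B w) (A w + B w.+1).

(** Two octahedron cells are stacked and linked by [slide] and [insertion] along
    the edges that leave [be]; then they are linked in the same way along the
    edges that arrive at [ga].  All steps are subtraction-free identities, so
    they hold tropically. *)
Lemma cube_consistency (al be de ga al2 be2 de2 ga2 : nat -> int) (v : int) :
  ga 0%N = 0 -> ga2 0%N = 0 -> al2 0%N = 0 -> be2 0%N = 0 ->
  de 0%N = 0 -> de2 0%N = 0 ->
  octa al be de ga -> octa al2 be2 de2 ga2 ->
  slide al2 al be2 be -> insertion be de be2 de2 v ->
  slide ga2 ga de2 de /\ insertion al ga al2 ga2 v.
Proof.
move=> g0 g20 a20 b20 d0 d20 O O2 S V.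
have ES w :
    be w.+1 + ga2 w = v + Num.max (al2 w + de w.+1) (ga w + be2 w.+1) ->
    ga w.+1 + de2 w.+1 = Num.max (de w.+2 + ga2 w) (ga2 w.+1 + de w.+1).
  by move: (O w) (O2 w) (S w) (V w.+1); lia.
(* E w is a fourth three-term relation, across the diagonal of the cube. *)
have E w : be w.+1 + ga2 w = v + Num.max (al2 w + de w.+1) (ga w + be2 w.+1).
  elim: w => [|w IH]; first by move: (V 0%N); lia.
  by move: (ES w IH) (O2 w) (V w.+1); lia.
split=> w; first exact: ES.
by move: (E w) (O w) (S w); lia.
Qed.

(** In terms of column lengths: [N_(w+1)(b) <= N_w(a) <= N_w(b)], as for a
    vertical strip [b / a]. *)
Definition nested (a b : nat -> int) : Prop := forall w,
  b w.+2 - b w.+1 <= a w.+1 - a w <= b w.+1 - b w.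

Lemma octa_nested (al be de ga : nat -> int) :
  ga 0%N = 0 -> al 0%N = 0 -> de 0%N = 0 -> be 0%N = 0 ->
  nested al be -> nested de be -> octa al be de ga ->
  nested ga al /\ nested ga de.
Proof.
move=> g0 a0 d0 b0 Na Nd O.
have L w : al w + de w <= ga w + be w.
  by case: w => [|w]; [lia | move: (O w); lia].
split=> w; move: (O w) (L w) (Na w) (Nd w) (Na w.+1) (Nd w.+1); lia.
Qed.

Lemma nested_zero (a b : nat -> int) :
  nested a b -> a 0%N = 0 -> (forall w, b w = 0) -> forall w, a w = 0.
Proof.
move=> N a0 b0; elim=> [//|w IH].
by move: (N w); rewrite !b0 IH; lia.
Qed.

(** [s] is the eventual value of the sequence [a]; for the truncated sums of a
    partition it is the size of the partition. *)
Definition stable (a : nat -> int) (s : int) : Prop :=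
  exists W, forall w, (W <= w)%N -> a w = s.

Lemma stable_slide a b b' c sa sb sb' sc :
  stable a sa -> stable b sb -> stable b' sb' -> stable c sc ->
  slide a b b' c -> sb + sb' = sa + sc.
Proof.
move=> [W1 h1] [W2 h2] [W3 h3] [W4 h4] S.
set t := (W1 + W2 + W3 + W4)%N.
move: (S t) (h1 t) (h1 t.+1) (h2 t.+1) (h3 t.+1) (h4 t.+1) (h4 t.+2); lia.
Qed.

Lemma stable_insertion R A B D v sR sA sB sD :
  stable R sR -> stable A sA -> stable B sB -> stable D sD ->
  insertion R A B D v -> sR + sD = v + sA + sB.
Proof.
move=> [W1 h1] [W2 h2] [W3 h3] [W4 h4] S.
set t := (W1 + W2 + W3 + W4)%N.
move: (S t) (h1 t.+1) (h2 t) (h2 t.+1) (h3 t) (h3 t.+1) (h4 t); lia.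
Qed.

Lemma nested_stable a b s : nested a b -> stable b s -> exists s', stable a s'.
Proof.
move=> N [W h]; exists (a W), W => w lw; rewrite -(subnKC lw).
elim: (w - W)%N => [|m IH]; first by rewrite addn0.
rewrite addnS -IH.
by move: (N (W + m)%N) (h (W + m)%N) (h (W + m).+1) (h (W + m).+2); lia.
Qed.

(** * Truncated sums and column lengths *)

Section Rows.
Variable r : nat.
Implicit Types (p q : pred 'I_r) (la mu nu ka : 'rV[int]_r) (w : nat).

(** The number of boxes in the first [w] columns. *)
Definition trunc_sum la w : int := \sum_k Num.min (la 0 k) w%:Z.

(** The number of boxes. *)
Definition weight la : int := \sum_k la 0 k.

(** The length of column [w], for [w > 0]; column [0] has length [r]. *)
Definition colht la w : nat := (\sum_(k < r) ((w%:Z <= la 0 k)%R : nat))%N.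

Lemma trunc_sumS la w : trunc_sum la w.+1 = trunc_sum la w + (colht la w.+1)%:Z.
Proof.
rewrite /trunc_sum /colht (big_morph Posz PoszD (erefl _)) -big_split /=.
by apply: eq_bigr => k _; case: leP; lia.
Qed.

(** [p] holds on an initial segment of the rows. *)
Definition down p := forall i j : 'I_r, (i <= j)%N -> p j -> p i.

Lemma downE p (k : 'I_r) : down p -> p k = (k < \sum_(j < r) (p j : nat))%N.
Proof.
move=> dp.
have cnt (m : nat) : (m <= r)%N -> (\sum_(j < r) ((j < m)%N : nat) = m)%N.
  move=> lm; rewrite -big_mkcond /= -(big_ord_widen _ (fun=> 1%N)) //.
  by rewrite sum1_card card_ord.
apply/idP/idP => [pk|].
  apply: (leq_trans (n := \sum_(j < r) (j < k.+1 : nat))); first by rewrite cnt.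
  apply: leq_sum => j _.
  by case: ltnP => // jk; rewrite (dp j k).
apply: contraTT => npk; rewrite -leqNgt.
apply: (leq_trans (n := \sum_(j < r) (j < k : nat)));
  last by rewrite cnt // ltnW.
apply: leq_sum => j _; case: (boolP (p j)) => // pj.
by case: (ltnP j k) => // kj; rewrite (dp k j) in npk.
Qed.

Lemma down_total p q : down p -> down q ->
  (forall j, p j -> q j) \/ (forall j, q j -> p j).
Proof.
move=> dp dq;
have := leqP (\sum_(j < r) (p j : nat)) (\sum_(j < r) (q j : nat)); case.
  move=> le; left=> j; rewrite (downE j dp) (downE j dq); lia.
move=> le; right=> j; rewrite (downE j dp) (downE j dq); lia.
Qed.

(** Initial segments are totally ordered by inclusion, so intersection and union
    have the minimal and the maximal size. *)
Lemma sum_downI p q : down p -> down q ->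
  (\sum_(j < r) (p j && q j : nat) =
   minn (\sum_(j < r) (p j : nat)) (\sum_(j < r) (q j : nat)))%N.
Proof.
move=> dp dq; case: (down_total dp dq) => h.
  rewrite (minn_idPl _).
    by apply: eq_bigr => j _; case: (boolP (p j)) => // /h ->.
  by apply: leq_sum => j _; move: (h j); case: (p j) => // ->.
rewrite (minn_idPr _).
  by apply: eq_bigr => j _; case: (boolP (q j)) => [/h ->|]; rewrite ?andbF.
by apply: leq_sum => j _; move: (h j); case: (q j) => // ->.
Qed.

Lemma sum_downU p q : down p -> down q ->
  (\sum_(j < r) (p j || q j : nat) =
   maxn (\sum_(j < r) (p j : nat)) (\sum_(j < r) (q j : nat)))%N.
Proof.
move=> dp dq; have := sum_downI dp dq.
have : (\sum_(j < r) (p j || q j : nat) + \sum_(j < r) (p j && q j : nat) =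
        \sum_(j < r) (p j : nat) + \sum_(j < r) (q j : nat))%N.
  by rewrite -!big_split; apply: eq_bigr => j _; case: (p j); case: (q j).
lia.
Qed.

Lemma down_part la w : is_partition la -> down (fun k => w%:Z <= la 0 k).
Proof. by move=> [_ h] i j ij hw; apply: le_trans hw (h _ _ ij). Qed.

Lemma colhtE la w (k : 'I_r) :
  is_partition la -> (w%:Z <= la 0 k) = (k < colht la w)%N.
Proof. by move=> pl; rewrite (downE k (down_part (w := w) pl)). Qed.

Lemma colht_cap la mu w : is_partition la -> is_partition mu ->
  colht (cap la mu) w = minn (colht la w) (colht mu w).
Proof.
move=> pl pm; rewrite /colht -sum_downI; try exact: down_part.
by apply: eq_bigr => k _; rewrite mxE le_min.
Qed.

Lemma part_cap la mu : is_partition la -> is_partition mu ->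
  is_partition (cap la mu).
Proof.
move=> [l0 ld] [m0 md]; split=> [i|i j ij]; rewrite !mxE.
  by move: (l0 i) (m0 i); lia.
by move: (ld i j ij) (md i j ij); lia.
Qed.

Lemma trunc_sum0 la : is_partition la -> trunc_sum la 0 = 0.
Proof.
by move=> [l0 _]; rewrite /trunc_sum big1 // => k _; move: (l0 k); lia.
Qed.

Lemma trunc_sum_stable la : stable (trunc_sum la) (weight la).
Proof.
exists (\sum_(k < r) `|la 0%R k|)%N => w lw; apply: eq_bigr => k _.
have : (`|la 0%R k| <= \sum_(k < r) `|la 0%R k|)%N
  by rewrite (bigD1 k) //= leq_addr.
lia.
Qed.

(** [la / mu] is a vertical strip. *)
Definition vstrip mu la := forall k : 'I_r, la 0 k - 1 <= mu 0 k <= la 0 k.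

(** * The Burge rules as an octahedron recurrence *)

Lemma ord_down_ind (P : nat -> Prop) :
  P r -> (forall k : 'I_r, P k.+1 -> P k) -> forall k, (k <= r)%N -> P k.
Proof.
move=> Pr Ps k lk; rewrite -(subKn lk).
elim: (r - k)%N (leq_subr k r) => [|m IH] lm; first by rewrite subn0.
have lt : (r - m.+1 < r)%N by lia.
have e : (r - m.+1).+1 = (r - m)%N by lia.
by apply: (Ps (Ordinal lt)); rewrite /= e; apply: IH; lia.
Qed.

Section Burge.
Variables al be de : 'rV[int]_r.
Hypotheses (pal : is_partition al) (pbe : is_partition be)
  (pde : is_partition de) (sal : vstrip al be) (sde : vstrip de be).

(* The state of the loop once the rows of index at least k are treated. *)
Let state (k : nat) : 'rV[int]_r * int :=
  foldr (fun i s => burge_step al be de s i) (0, 0)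
    [seq i : 'I_r <- drop k (enum 'I_r) | (i < nb_parts be)%N].

(* The amount removed from the carry at row k. *)
Let taken (k : 'I_r) : int :=
  Num.min (if (be 0 k == de 0 k) && (de 0 k == al 0 k) then 1 else 0)
          (state k.+1).2.

Lemma burge_stateE : burge al be de = state 0.
Proof. by rewrite /burge /state drop0 foldl_rev. Qed.

Lemma burge_state_end k : (r <= k)%N -> state k = (0, 0).
Proof. by move=> lk; rewrite /state drop_oversize // size_enum_ord. Qed.

Lemma burge_state_step (k : 'I_r) :
  state k = if (k < nb_parts be)%N then burge_step al be de (state k.+1) k
            else state k.+1.
Proof.
rewrite /state (drop_nth k) ?size_enum_ord // nth_ord_enum /=.
by case: ifP.
Qed.

Lemma nb_parts_out (k : 'I_r) : (nb_parts be <= k)%N ->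
  [/\ be 0 k = 0, al 0 k = 0 & de 0 k = 0].
Proof.
move=> lk; have [b0 _] := pbe; have [a0 _] := pal; have [d0 _] := pde.
have e0 : (0 : 'I_1) = ord0 by apply: val_inj.
have : ~~ (0 < be 0 k).
  apply: contraL lk; rewrite e0 => bk; rewrite -ltnNge /nb_parts.
  exact: (leq_bigmax_cond (F := fun j : 'I_r => j.+1)).
by move: (a0 k) (b0 k) (d0 k) (sal k) (sde k) => *; split; lia.
Qed.

Lemma burge_state_out (k : nat) :
  (k <= r)%N -> (nb_parts be <= k)%N -> state k = (0, 0).
Proof.
move=> lk; move: k lk; apply: ord_down_ind => [_|k IH lk].
  exact: burge_state_end.
by rewrite burge_state_step ltnNge lk /= IH // ltnW.
Qed.

Lemma burge_carry_step (k : 'I_r) :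
  (state k).2 = (state k.+1).2 - taken k + be 0 k - Num.max (de 0 k) (al 0 k).
Proof.
rewrite burge_state_step; case: ltnP => lk.
  by rewrite /burge_step /taken; case: (state k.+1).
have [b0 a0 d0] := nb_parts_out lk.
by rewrite /taken b0 a0 d0 burge_state_out // ltnW.
Qed.

Lemma burge_shape (k : 'I_r) :
  (burge al be de).1 0 k = Num.min (de 0 k) (al 0 k) - taken k.
Proof.
have base : (state k).1 0 k = Num.min (de 0 k) (al 0 k) - taken k.
  rewrite burge_state_step; case: ltnP => lk.
    rewrite /burge_step /taken; case: (state k.+1) => g c /=.
    by rewrite mxE eqxx.
  have [b0 a0 d0] := nb_parts_out lk.
  by rewrite /taken b0 a0 d0 burge_state_out ?mxE // ltnW.
have up (m : nat) : (m <= k)%N -> (state (k - m)).1 0 k = (state k).1 0 k.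
  elim: m => [|m IH] lm; first by rewrite subn0.
  have lt : (k - m.+1 < r)%N by move: (ltn_ord k); lia.
  have e : (k - m.+1).+1 = (k - m)%N by lia.
  have := burge_state_step (Ordinal lt); rewrite /= e => ->.
  rewrite -IH; last by lia.
  case: ifP => // _; rewrite /burge_step; case: (state (k - m)) => g c /=.
  rewrite mxE; case: eqP => // /(congr1 val) /=; lia.
by rewrite burge_stateE; move: (up k (leqnn k)); rewrite subnn => ->.
Qed.

Let ga := (burge al be de).1.
Let C k := (state k).2.

Lemma burge_carry_end k : (r <= k)%N -> C k = 0.
Proof. by move=> lk; rewrite /C burge_state_end. Qed.

(** Row [k] of [ga], and the carry around it: unless the row keeps its length in
    both [al] and [de], it receives the minimum of the two. *)
Lemma burge_row (k : 'I_r) :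
  C k = C k.+1 + (be 0 k + ga 0 k - al 0 k - de 0 k) /\
  (al 0 k = be 0 k /\ de 0 k = be 0 k /\ ga 0 k = be 0 k - Num.min 1 (C k.+1) \/
   (al 0 k < be 0 k \/ de 0 k < be 0 k) /\ ga 0 k = Num.min (de 0 k) (al 0 k)).
Proof.
rewrite /ga burge_shape; split.
  by rewrite /C burge_carry_step /taken; lia.
have c0 : 0 <= C k.+1.
  case: (leqP r k.+1) => [/burge_carry_end ->//|/ltnW]; move: k.+1.
  apply: ord_down_ind => [|j IH]; first by rewrite burge_carry_end.
  rewrite /C burge_carry_step /taken -/(C _).
  by move: (sal j) (sde j); case: ifP; lia.
rewrite /taken -/(C _); move: (sal k) (sde k).
by case: eqP => [->|] /=; [case: eqP => [->|] /=|]; lia.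
Qed.

Lemma burge_carry_ge0 k : 0 <= C k.
Proof.
case: (leqP r k) => [/burge_carry_end ->//|/ltnW]; move: k.
apply: ord_down_ind => [|k IH]; first by rewrite burge_carry_end.
by have [] := burge_row k; move: (sal k) (sde k); lia.
Qed.

(** A row that keeps its length in [ga] finds an empty carry, and the carry
    stays empty along the rows of the same length above it. *)
Lemma burge_carry_eq0 (i j : 'I_r) : (i <= j)%N -> be 0 i = be 0 j ->
  be 0 j <= ga 0 j -> C i = 0.
Proof.
move=> ij eb gj.
have cj : C j = 0.
  by have [] := burge_row j; move: (burge_carry_ge0 j) (burge_carry_ge0 j.+1)
    (sal j) (sde j); lia.
have [_ ad] := pal; have [_ bd] := pbe; have [_ dd] := pde.
have aj : be 0 j = al 0 j /\ be 0 j = de 0 j.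
  by have [] := burge_row j; move: (burge_carry_ge0 j.+1) (sal j) (sde j); lia.
have up (m : nat) : (m <= j - i)%N -> C (j - m) = 0.
  elim: m => [|m IH] lm; first by rewrite subn0.
  have lt : (j - m.+1 < r)%N by move: (ltn_ord j); lia.
  have e : (j - m.+1).+1 = (j - m)%N by lia.
  have l1 : (i <= Ordinal lt)%N by rewrite /=; lia.
  have l2 : (Ordinal lt <= j)%N by rewrite /=; lia.
  have := burge_row (Ordinal lt); rewrite /= e IH; last by lia.
  move: (bd _ _ l1) (bd _ _ l2) (ad _ _ l2) (dd _ _ l2).
  move: (sal (Ordinal lt)) (sde (Ordinal lt)); lia.
by rewrite -(subKn ij) up.
Qed.

(** If row [k] finds a nonempty carry, then every row of the same length below
    it is shorter in [ga]. *)
Lemma burge_carry_below (k j : 'I_r) : (k < j)%N -> be 0 j = be 0 k ->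
  0 < C k.+1 -> ga 0 j < be 0 j.
Proof.
move=> kj eb ck; rewrite ltNge; apply/negP => gj.
have lt : (k.+1 < r)%N by apply: leq_ltn_trans kj _.
have l1 : (k <= Ordinal lt)%N by rewrite /=.
have l2 : (Ordinal lt <= j)%N by rewrite /=.
have [_ bd] := pbe.
have := burge_carry_eq0 l2 _ gj; rewrite /=.
by move: (bd _ _ l1) (bd _ _ l2); lia.
Qed.

Lemma burge_part : is_partition ga.
Proof.
have [a0 ad] := pal; have [b0 bd] := pbe; have [d0 dd] := pde.
split=> [k|i j].
  have [_ gk] := burge_row k.
  case: (ltrP 0 (C k.+1)) => ck; last by move: (a0 k) (d0 k); lia.
  case: (ltrP 0 (be 0 k)) => bk; first by move: (a0 k) (d0 k); lia.
  have lt : (r.-1 < r)%N by move: (ltn_ord k); lia.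
  have kl : (k <= Ordinal lt)%N by move: (ltn_ord k); rewrite /=; lia.
  have bl : be 0 (Ordinal lt) = be 0 k.
    by move: (bd _ _ kl) (b0 (Ordinal lt)) (b0 k); lia.
  have cr : C (Ordinal lt).+1 = 0 by apply: burge_carry_end; rewrite /=; lia.
  have kl2 : (k < Ordinal lt)%N.
    rewrite ltn_neqAle kl andbT; apply/eqP => e.
    by move: ck; rewrite e cr.
  have := burge_carry_below kl2 bl ck.
  have [_] := burge_row (Ordinal lt); rewrite cr.
  by move: (b0 (Ordinal lt)) (a0 (Ordinal lt)) (d0 (Ordinal lt)); lia.
rewrite leq_eqVlt => /orP[/eqP/val_inj->//|ij].
have := burge_carry_below ij; have [_ gi] := burge_row i.
have [_ gj] := burge_row j.
move: (ad _ _ (ltnW ij)) (bd _ _ (ltnW ij)) (dd _ _ (ltnW ij)).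
move: (sal i) (sal j) (sde i) (sde j) (burge_carry_ge0 i.+1)
  (burge_carry_ge0 j.+1).
move: gi gj; lia.
Qed.

Lemma burge_vstrip : vstrip ga al /\ vstrip ga de.
Proof.
split=> k; have [_ gk] := burge_row k; move: gk;
  move: (sal k) (sde k) (burge_carry_ge0 k.+1); lia.
Qed.

Lemma burge_carry_sum t : (t <= r)%N ->
  C t = \sum_(k < r) (if (t <= k)%N then be 0 k + ga 0 k - al 0 k - de 0 k
                      else 0).
Proof.
move: t; apply: ord_down_ind => [|t IH].
  rewrite burge_carry_end // big1 // => k _.
  by rewrite leqNgt ltn_ord.
have [-> _] := burge_row t; rewrite IH.
rewrite (bigD1 t) //= [in RHS](bigD1 t) //= ltnn leqnn add0r addrC.
congr (_ + _); apply: eq_bigr => k kt.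
by rewrite ltn_neqAle eq_sym kt.
Qed.

Lemma burge_filling :
  (burge al be de).2 = weight be + weight ga - weight al - weight de.
Proof.
by rewrite burge_stateE -/(C 0) burge_carry_sum //= /weight -big_split /=
  -!sumrB.
Qed.

(** At [w + 1], the difference between the left side and the first term of the
    maximum is the carry after the rows of length at most [w + 1] in [be]; the
    difference with the second term is the number of rows of length [w + 1] in
    both [be] and [ga].  One of them vanishes by [burge_carry_eq0]. *)
Lemma burge_octa :
  octa (trunc_sum al) (trunc_sum be) (trunc_sum de) (trunc_sum ga).
Proof.
move=> w; set t := colht be w.+2.
have tr : (t <= r)%N.
  rewrite /t /colht -[X in (_ <= X)%N]card_ord -sum1_card.
  by apply: leq_sum => k _; case: (_ <= _).
have tP (k : 'I_r) : (t <= k)%N = (be 0 k <= w.+1%:Z).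
  by rewrite leqNgt -colhtE // -ltNge; lia.
have Ct : C t = trunc_sum ga w.+1 + trunc_sum be w.+1
                - trunc_sum al w.+1 - trunc_sum de w.+1.
  rewrite burge_carry_sum // /trunc_sum -big_split /= -!sumrB.
  apply: eq_bigr => k _; rewrite tP; have [_] := burge_row k.
  move: (sal k) (sde k) (burge_carry_ge0 k.+1).
  by case: (boolP (be 0 k <= w.+1%:Z)); lia.
have sub k : (w.+2%:Z <= be 0 k) -> (w.+1%:Z <= ga 0 k).
  have [_] := burge_row k.
  by move: (sal k) (sde k) (burge_carry_ge0 k.+1); lia.
have N2 : (colht be w.+2 <= colht ga w.+1)%N.
  by apply: leq_sum => k _; move: (sub k); case: (_ <= be 0 k) => // ->.
have N1 : C t = 0 \/ colht ga w.+1 = colht be w.+2.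
  case: (boolP [exists j : 'I_r, (be 0 j <= w.+1%:Z) && (w.+1%:Z <= ga 0 j)]).
    case/existsP=> j /andP[bj gj]; left.
    have tj : (t <= j)%N by rewrite tP.
    have lt : (t < r)%N by apply: leq_ltn_trans tj _.
    have [_ bd] := pbe.
    have := bd (Ordinal lt) j tj.
    have := tP (Ordinal lt); rewrite leqnn => /esym h1 h2.
    apply: (@burge_carry_eq0 (Ordinal lt) j) => //; last by lia.
    have [_] := burge_row j.
    by move: (sal j) (sde j) (burge_carry_ge0 j.+1); lia.
  rewrite negb_exists => /forallP h; right.
  apply: eq_bigr => k _; move: (h k) (sub k).
  by case: (boolP (w.+2%:Z <= be 0 k)); case: (boolP (w.+1%:Z <= ga 0 k)); lia.
move: (burge_carry_ge0 t) (trunc_sumS ga w) (trunc_sumS be w.+1); lia.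
Qed.
End Burge.
End Rows.

(** * The local rule of promotion *)

Section Dominant.
Variable r : nat.
Implicit Types (x la mu nu ka : 'rV[int]_r) (w : nat).

Lemma colht_dom x w :
  colht (dom x) w = (\sum_(k < r) ((w%:Z <= `|x 0 k|)%R : nat))%N.
Proof.
set s := sort >=%R [seq `|x 0 k| | k <- enum 'I_r].
have ss : size s = r by rewrite size_sort size_map size_enum_ord.
transitivity (\sum_(y <- s) ((w%:Z <= y)%R : nat))%N.
  by rewrite (big_nth 0) big_mkord ss; apply: eq_bigr => k _; rewrite mxE.
rewrite (perm_big [seq `|x 0 k| | k <- enum 'I_r]) ?perm_sort //=.
by rewrite big_map big_enum.
Qed.

Lemma dom_mem x (k : 'I_r) : exists j : 'I_r, dom x 0 k = `|x 0 j|.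
Proof.
rewrite mxE; set s := sort _ _.
have : s`_k \in s by rewrite mem_nth // size_sort size_map size_enum_ord.
by rewrite mem_sort => /mapP[j _ ->]; exists j.
Qed.

Lemma dom_part x : is_partition (dom x).
Proof.
split=> [i|i j ij]; first by have [j ->] := dom_mem x i; apply: normr_ge0.
rewrite !mxE; set s := sort _ _.
have ss : size s = r by rewrite size_sort size_map size_enum_ord.
have tr : transitive (>=%R : rel int).
  by move=> a b c /= h1 h2; apply: le_trans h2 h1.
have so : sorted >=%R s by apply: sort_sorted => a b; apply: le_total.
by apply: (sorted_leq_nth tr (fun a => lexx a) 0 so) => //; rewrite ?inE ?ss.
Qed.

(** A step of a fan: every entry changes by one. *)
Definition spin la mu :=
  forall k : 'I_r, (mu - la) 0 k = 1 \/ (mu - la) 0 k = -1.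

(** All entries have the same parity, as holds along a fan: odd if [p] is true,
    even otherwise. *)
Definition parity (p : bool) la := forall k : 'I_r, odd `|la 0%R k|%N = p.

Lemma spinE la mu (k : 'I_r) : spin la mu ->
  mu 0 k = la 0 k + 1 \/ mu 0 k = la 0 k - 1.
Proof.
move=> s; have := s k; rewrite !mxE => -[e|e]; [left|right];
  by rewrite -[mu 0 k](subrK (la 0 k)) e addrC.
Qed.

Lemma spin_intro la mu :
  (forall k : 'I_r, mu 0 k = la 0 k + 1 \/ mu 0 k = la 0 k - 1) -> spin la mu.
Proof.
by move=> s k; rewrite !mxE; case: (s k) => ->; [left|right];
  rewrite addrAC subrr add0r.
Qed.

Lemma spinC la mu : spin la mu -> spin mu la.
Proof. by move=> s; apply: spin_intro => k; move: (spinE k s); lia. Qed.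

Lemma mxE_add_sub ka nu la (k : 'I_r) :
  (ka + nu - la) 0 k = ka 0 k + nu 0 k - la 0 k.
Proof. by rewrite !mxE. Qed.

Lemma spin_parity p la mu : spin la mu -> parity p la -> parity (~~ p) mu.
Proof.
by move=> s h k; move: (spinE k s); rewrite -(h k); lia.
Qed.

Lemma parity_colht p la w : parity p la -> odd w != p ->
  colht la w = colht la w.+1.
Proof. by move=> h wp; apply: eq_bigr => k _; move: (h k) wp; lia. Qed.

Lemma spin_colht la mu w : spin la mu ->
  (colht la w.+1 <= colht mu w)%N /\ (colht mu w.+1 <= colht la w)%N.
Proof.
by move=> s; split; apply: leq_sum => k _; move: (spinE k s); lia.
Qed.

Lemma colht0 la : is_partition la -> colht la 0 = r.
Proof.
move=> [l0 _]; rewrite /colht (eq_bigr (fun=> 1%N)) => [|k _].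
  by rewrite sum1_card card_ord.
by rewrite l0.
Qed.

Section Dom.
Variables (p : bool) (la nu ka : 'rV[int]_r).
Hypotheses (pl : is_partition la) (pn : is_partition nu) (pk : is_partition ka).
Hypotheses (sn : spin la nu) (sk : spin ka la) (hp : parity p la).

Let mu := dom (ka + nu - la).

(** The toggle rule, row by row: sorting does not change column lengths, and the
    absolute value only affects an entry [-1], which no column of index at least
    [2] sees. *)
Lemma dom_colht w : odd w = p ->
  (colht mu w.+2 + colht la w.+2 =
   minn (colht ka w.+1) (colht nu w.+1) +
   maxn (colht ka w.+3) (colht nu w.+3))%N.
Proof.
move=> wp; rewrite colht_dom -sum_downI; try exact: down_part.
rewrite -sum_downU; try exact: down_part.
rewrite -!big_split /=; apply: eq_bigr => k _.
have [l0 _] := pl; have [k0 _] := pk; have [n0 _] := pn.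
move: (l0 k) (k0 k) (n0 k) (spinE k sn) (spinE k sk) (hp k);
  rewrite mxE_add_sub; lia.
Qed.

(** A row is negative exactly when [la = 1] and [ka = nu = 0]. *)
Lemma dom_nb_neg : (nb_neg (ka + nu - la) =
  if p then r - maxn (colht ka 1) (colht nu 1) else 0)%N.
Proof.
have [l0 _] := pl; have [k0 _] := pk; have [n0 _] := pn.
rewrite /nb_neg cardsE -sum1_card big_mkcond /=; case: ifP => pp.
  rewrite -sum_downU; try exact: down_part.
  have er : (\sum_(k < r) 1 = r)%N by rewrite sum1_card card_ord.
  rewrite -[X in (X - _)%N]er -sumnB; last by move=> k _; case: (_ || _).
  apply: eq_bigr => k _;
  move: (l0 k) (k0 k) (n0 k) (spinE k sn) (spinE k sk) (hp k).
  by rewrite unfold_in mxE_add_sub; case: ifP; lia.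
rewrite big1 // => k _.
move: (l0 k) (k0 k) (n0 k) (spinE k sn) (spinE k sk) (hp k).
by rewrite unfold_in mxE_add_sub; case: ifP; lia.
Qed.

Lemma dom_parity : parity p mu.
Proof.
move=> k; have [j ->] := dom_mem (ka + nu - la) k.
move: (hp j) (spinE j sn) (spinE j sk); rewrite mxE_add_sub; lia.
Qed.

Lemma dom_spin : spin ka mu /\ spin nu mu.
Proof.
have hk : parity (~~ p) ka.
  by move=> k; move: (spinE k sk) (hp k); lia.
have hn := spin_parity sn hp.
have pm : is_partition mu := dom_part _.
suff gen (x : 'rV_r) : is_partition x -> parity (~~ p) x ->
    (forall w, odd w = p ->
      (colht x w.+3 <= colht mu w.+2 <= colht x w.+1)%N) -> spin x mu.
  split; apply: gen => // w wp; have := dom_colht wp;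
  have [] := spin_colht w.+1 sn; have [] := spin_colht w.+1 sk;
  have [] := spin_colht w.+2 sn; have [] := spin_colht w.+2 sk; lia.
move=> px hx H; apply: spin_intro => k.
have [m0 _] := pm; have [x0 _] := px.
have e1 (w : nat) : odd w = p -> w.+2%:Z <= mu 0 k -> w.+1%:Z <= x 0 k.
  by move=> wp; rewrite !colhtE //; move: (H w wp); lia.
have e2 (w : nat) : odd w = p -> w.+3%:Z <= x 0 k -> w.+2%:Z <= mu 0 k.
  by move=> wp; rewrite !colhtE //; move: (H w wp); lia.
have f1 : mu 0 k <= x 0 k + 1.
  case: (lerP 2 (mu 0 k)) => h.
    by move: (e1 (`|mu 0%R k| - 2)%N) (dom_parity k); lia.
  by move: (x0 k) (m0 k); lia.
have f2 : x 0 k <= mu 0 k + 1.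
  case: (lerP 3 (x 0 k)) => h.
    by move: (e2 (`|x 0%R k| - 3)%N) (hx k); lia.
  by move: (x0 k) (m0 k) (hx k) (dom_parity k); lia.
move: (hx k) (dom_parity k) (x0 k) (m0 k); lia.
Qed.
End Dom.
End Dominant.

(** * The corners of the three layers along the diagonal *)

(** The sequence of truncated sums with column lengths [f 1, f 2, ...]. *)
Definition psum (f : nat -> nat) (w : nat) : int := (\sum_(i < w) f i.+1)%N%:Z.

Lemma psumS f w : psum f w.+1 = psum f w + (f w.+1)%:Z.
Proof. by rewrite /psum big_ord_recr. Qed.

Lemma psum0 f : psum f 0 = 0.
Proof. by rewrite /psum big_ord0. Qed.

Lemma psum_nested f g :
  (forall w, g w.+2 <= f w.+1 <= g w.+1)%N -> nested (psum f) (psum g).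
Proof. by move=> h w; rewrite !psumS; move: (h w); lia. Qed.

(** Local form of [slide]: column by column, [b] is reflected in the interval
    allowed by interlacing with [a] and [c]; column [1] has no upper bound from
    [a]. *)
Lemma psum_slide (a b b' c : nat -> nat) :
  (b 1 + b' 1 = c 1 + maxn (c 2) (a 1))%N ->
  (forall w, b w.+2 + b' w.+2 =
             minn (c w.+2) (a w.+1) + maxn (c w.+3) (a w.+2))%N ->
  slide (psum a) (psum b) (psum b') (psum c).
Proof.
move=> h1 h2 w.
suff : psum b w.+1 + psum b' w.+1 =
    psum c w.+1 + psum a w + (maxn (c w.+2) (a w.+1))%:Z.
  by rewrite !(psumS c w.+1) !(psumS a w); lia.
elim: w => [|w IH]; first by rewrite !psumS !psum0; lia.
by rewrite (psumS b) (psumS b') (psumS c) (psumS a w); move: IH (h2 w); lia.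
Qed.

(** Local form of [insertion]: the row insertion rule, column by column. *)
Lemma psum_insertion (R A B D : nat -> nat) (v : nat) :
  (R 1 = v + maxn (A 1) (B 1))%N ->
  (forall w, R w.+2 + D w.+1 =
             maxn (A w.+2) (B w.+2) + minn (A w.+1) (B w.+1))%N ->
  insertion (psum R) (psum A) (psum B) (psum D) v.
Proof.
move=> h1 h2 w.
suff : psum R w.+1 + psum D w =
    v%:Z + psum A w + psum B w + (maxn (A w.+1) (B w.+1))%:Z.
  by rewrite !(psumS A w) !(psumS B w); lia.
elim: w => [|w IH]; first by rewrite !psumS !psum0; lia.
by rewrite (psumS R) (psumS D) (psumS A) (psumS B); move: IH (h2 w); lia.
Qed.

(** Column lengths of the middle layer at the point just below two consecutive
    points of the diagonal, the first labelled [la] in one triangle and [ka] in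
    the other, the second [nu] and [mu]; [p] is the parity of [la].  The labels
    enter through [ka] and [nu] only. *)
Definition overlap (p : bool) (k n : nat -> nat) (w : nat) : nat :=
  if odd w == p then minn (k w) (n w) else maxn (k w.+1) (n w.+1).

Lemma overlapC p k n w : overlap p k n w = overlap p n k w.
Proof. by rewrite /overlap minnC maxnC. Qed.

(* The sequences l, n, k, m are the column lengths of la, nu, ka and
   mu = dom (ka + nu - la), known through parity, interlacing and the toggle
   rule; the hypotheses are symmetric under l <-> m and under n <-> k. *)
Section Corner.
Variables (p : bool) (r : nat) (l n k m : nat -> nat).
Hypotheses (hl : forall w, odd w != p -> l w = l w.+1)
  (hm : forall w, odd w != p -> m w = m w.+1)
  (hn : forall w, odd w = p -> n w = n w.+1)
  (hk : forall w, odd w = p -> k w = k w.+1).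
Hypotheses (ln : forall w, (l w.+1 <= n w)%N /\ (n w.+1 <= l w)%N)
  (lk : forall w, (l w.+1 <= k w)%N /\ (k w.+1 <= l w)%N)
  (mn : forall w, (m w.+1 <= n w)%N /\ (n w.+1 <= m w)%N)
  (mk : forall w, (m w.+1 <= k w)%N /\ (k w.+1 <= m w)%N).
Hypothesis tog : forall w, odd w = p ->
  (m w.+2 + l w.+2 = minn (k w.+1) (n w.+1) + maxn (k w.+3) (n w.+3))%N.
Hypotheses (l0 : l 0 = r) (n0 : n 0 = r) (k0 : k 0 = r) (m0 : m 0 = r).

Lemma corner_slide :
  slide (psum (overlap p k n)) (psum (fun w => minn (l w) (n w)))
        (psum (fun w => minn (n w) (m w))) (psum n).
Proof.
apply: psum_slide => [|w].
  move: (@hl 0%N) (@hn 0%N) (@hl 1%N) (@hm 0%N) (@hm 1%N) (@hn 1%N)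
    (@hk 0%N) (@hk 1%N) (ln 0%N) (ln 1%N)
    (lk 0%N) (lk 1%N) (mn 0%N) (mn 1%N) (mk 0%N) (mk 1%N)
    (@tog 0%N) (@hn 2) (@hk 2).
  by rewrite /overlap; case: p => /=; lia.
move: (@hl w.+2) (@hm w.+2) (@hn w.+1) (@hn w.+2) (@hk w.+1) (@hk w.+2)
  (@hn w.+3) (@hk w.+3) (@tog w.+1)
  (ln w.+2) (mn w.+2) (lk w.+2) (mk w.+2) (ln w.+1) (mn w.+1).
by rewrite /overlap /= !negbK; case: p; case: (odd w) => /=; lia.
Qed.

Lemma corner_insertion (v : nat) :
  v = (if p then r - maxn (k 1) (n 1) else 0)%N ->
  insertion (psum l) (psum (fun w => minn (l w) (n w)))
    (psum (fun w => minn (l w) (k w))) (psum (overlap p k n)) v.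
Proof.
clear m0; move=> ->; apply: psum_insertion => [|w].
  move: (@hl 0%N) (@hn 0%N) (@hl 1%N) (@hn 1%N) (@hk 0%N) (@hk 1%N) (ln 0%N)
    (ln 1%N) (lk 0%N) (lk 1%N).
  by case: p => /=; lia.
move: (@hl w.+1) (@hn w.+1) (@hk w.+1) (@hl w.+2) (@hn w.+2) (@hk w.+2)
  (ln w.+1) (lk w.+1) (ln w.+2) (lk w.+2) (ln w) (lk w).
by rewrite /overlap /= !negbK; case: p; case: (odd w) => /=; lia.
Qed.

Lemma corner_nested :
  nested (psum (overlap p k n)) (psum (fun w => minn (l w) (k w))).
Proof.
clear l0 n0 k0 m0; apply: psum_nested => w.
move: (@hl w.+1) (@hn w.+1) (@hk w.+1) (@hl w.+2) (@hn w.+2) (@hk w.+2)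
  (ln w.+1) (lk w.+1) (ln w.+2) (lk w.+2).
by rewrite /overlap /= !negbK; case: p; case: (odd w) => /=; lia.
Qed.
End Corner.

Lemma slide_ext a a' b b' c c' d d' :
  a =1 a' -> b =1 b' -> c =1 c' -> d =1 d' ->
  slide a b c d -> slide a' b' c' d'.
Proof. by move=> ea eb ec ed S w; rewrite -!ea -!eb -!ec -!ed. Qed.

Lemma insertion_ext a a' b b' c c' d d' v :
  a =1 a' -> b =1 b' -> c =1 c' -> d =1 d' ->
  insertion a b c d v -> insertion a' b' c' d' v.
Proof. by move=> ea eb ec ed S w; rewrite -!ea -!eb -!ec -!ed. Qed.

Lemma nested_ext a a' b b' : a =1 a' -> b =1 b' -> nested a b -> nested a' b'.
Proof. by move=> ea eb S w; rewrite -!ea -!eb. Qed.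

Lemma eq_psum f g : f =1 g -> psum f =1 psum g.
Proof. by move=> e w; rewrite /psum (eq_bigr _ (fun i _ => e _)). Qed.

Section Corners.
Variable r : nat.

Lemma trunc_sumE (la : 'rV[int]_r) :
  is_partition la -> psum (colht la) =1 trunc_sum la.
Proof.
by move=> pl; elim=> [|w IH]; rewrite ?psum0 ?trunc_sum0 // psumS trunc_sumS IH.
Qed.

Lemma trunc_sum_cap (la mu : 'rV[int]_r) :
  is_partition la -> is_partition mu ->
  psum (fun w => minn (colht la w) (colht mu w)) =1 trunc_sum (cap la mu).
Proof.
move=> pl pm w; rewrite -trunc_sumE; last exact: part_cap.
by apply: eq_psum => {}w; rewrite colht_cap.
Qed.

Lemma trunc_sum_capC (la mu : 'rV[int]_r) :
  is_partition la -> is_partition mu ->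
  psum (fun w => minn (colht la w) (colht mu w)) =1 trunc_sum (cap mu la).
Proof.
move=> pl pm w; rewrite -trunc_sum_cap //.
by apply: eq_psum => {}w; rewrite minnC.
Qed.

Variables (p : bool) (la nu ka : 'rV[int]_r).
Hypotheses (pl : is_partition la) (pn : is_partition nu) (pk : is_partition ka).
Hypotheses (sn : spin la nu) (sk : spin ka la) (hp : parity p la).
Let mu := dom (ka + nu - la).
Let th := psum (overlap p (colht ka) (colht nu)).
Let v := nb_neg (ka + nu - la).

(** The links of the two triangles with the middle layer between the diagonal
    and the level below it. *)
Lemma corner :
  [/\ slide th (trunc_sum (cap la nu)) (trunc_sum (cap nu mu)) (trunc_sum nu),
      slide th (trunc_sum (cap ka mu)) (trunc_sum (cap la ka)) (trunc_sum ka),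
      insertion (trunc_sum la) (trunc_sum (cap la nu))
        (trunc_sum (cap la ka)) th v,
      insertion (trunc_sum mu) (trunc_sum (cap ka mu))
        (trunc_sum (cap nu mu)) th v
    & nested th (trunc_sum (cap la ka)) /\ nested th (trunc_sum (cap nu mu))].
Proof.
have pm : is_partition mu := dom_part _.
have [skm snm] := dom_spin pl pn pk sn sk hp.
have hm := dom_parity sn sk hp.
have hn := spin_parity sn hp.
have hk : parity (~~ p) ka.
  by move=> k; move: (spinE k sk) (hp k); lia.
have pe (x : 'rV[int]_r) : parity p x ->
    forall w, odd w != p -> colht x w = colht x w.+1.
  by move=> h w; apply: parity_colht.
have po (x : 'rV[int]_r) : parity (~~ p) x ->
    forall w, odd w = p -> colht x w = colht x w.+1.
  by move=> h w e; apply: parity_colht h _; rewrite e; case: p.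
have ad (x y : 'rV[int]_r) : spin x y -> forall w,
    (colht x w.+1 <= colht y w)%N /\ (colht y w.+1 <= colht x w)%N.
  by move=> s w; apply: spin_colht.
have da (x y : 'rV[int]_r) : spin x y -> forall w,
    (colht y w.+1 <= colht x w)%N /\ (colht x w.+1 <= colht y w)%N.
  by move=> s w; have [] := spin_colht w s.
have tog w : odd w = p -> (colht mu w.+2 + colht la w.+2 =
    minn (colht ka w.+1) (colht nu w.+1) +
    maxn (colht ka w.+3) (colht nu w.+3))%N.
  exact: dom_colht.
have tog2 w : odd w = p -> (colht la w.+2 + colht mu w.+2 =
    minn (colht nu w.+1) (colht ka w.+1) +
    maxn (colht nu w.+3) (colht ka w.+3))%N.
  by move=> /tog; rewrite addnC minnC maxnC.
have ve : v = (if p then r - maxn (colht ka 1) (colht nu 1) else 0)%N.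
  by apply: dom_nb_neg.
have ve2 : v = (if p then r - maxn (colht nu 1) (colht ka 1) else 0)%N.
  by rewrite maxnC.
have thC : psum (overlap p (colht nu) (colht ka)) =1 th.
  by apply: eq_psum => w; rewrite overlapC.
have lE := pe _ hp; have mE := pe _ hm; have nE := po _ hn; have kE := po _ hk.
have ln := ad _ _ sn; have lk := da _ _ sk; have mn := da _ _ snm.
have mk := da _ _ skm.
have l0 := colht0 pl; have m0 := colht0 pm; have n0 := colht0 pn.
have k0 := colht0 pk.
split.
- apply: slide_ext (corner_slide lE mE nE kE ln lk mn mk tog l0 n0 k0 m0) => //.
  + exact: trunc_sum_cap.
  + exact: trunc_sum_cap.
  + exact: trunc_sumE.
- apply: slide_ext (corner_slide mE lE kE nE mk mn lk ln tog2 m0 k0 n0 l0)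
    => //.
  + exact: trunc_sum_capC.
  + exact: trunc_sum_capC.
  + exact: trunc_sumE.
- apply: insertion_ext (corner_insertion lE nE kE ln lk l0 n0 k0 ve) => //.
  + exact: trunc_sumE.
  + exact: trunc_sum_cap.
  + exact: trunc_sum_cap.
- apply: insertion_ext (corner_insertion mE kE nE mk mn m0 k0 n0 ve2) => //.
  + exact: trunc_sumE.
  + exact: trunc_sum_capC.
  + exact: trunc_sum_capC.
split.
- apply: nested_ext (corner_nested lE nE kE ln lk) => //.
  exact: trunc_sum_cap.
- apply: nested_ext (corner_nested mE kE nE mk mn) => //.
  exact: trunc_sum_capC.
Qed.
End Corners.

(** * Fans, promotion and the middle layer *)

Section Fans.
Variables (r n : nat).
Implicit Types (F : n.+1.-tuple 'rV[int]_r) (k x z : nat).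

Lemma nth_pr F j : (j < n)%N -> (pr F)`_j = pr_entry F j.
Proof.
move=> jn; have jn1 : (j < n.+1)%N by apply: ltnW.
by rewrite (nth_mktuple _ 0 (Ordinal jn1)) /= jn.
Qed.

Lemma nth_pr_last F : (pr F)`_n = 0.
Proof. by rewrite (nth_mktuple _ 0 (Ordinal (ltnSn n))) /= ltnn. Qed.

Lemma part0 : is_partition (0 : 'rV[int]_r).
Proof. by split=> [i|i j _]; rewrite !mxE. Qed.

Lemma trunc_sum_cap0l (la : 'rV[int]_r) w :
  is_partition la -> trunc_sum (cap 0 la) w = 0.
Proof.
by move=> [l0 _]; rewrite /trunc_sum big1 // => k _; move: (l0 k);
  rewrite !mxE; lia.
Qed.

Lemma trunc_sum_cap0r (la : 'rV[int]_r) w :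
  is_partition la -> trunc_sum (cap la 0) w = 0.
Proof.
by move=> [l0 _]; rewrite /trunc_sum big1 // => k _; move: (l0 k);
  rewrite !mxE; lia.
Qed.

Lemma fan_spin F j : is_fan F -> (j < n)%N -> spin F`_j F`_j.+1.
Proof. by move=> [_ _ _ h]; apply: h. Qed.

Lemma fan_parity F j : is_fan F -> (j <= n)%N -> parity (odd j) F`_j.
Proof.
move=> hF; elim: j => [_ k|j IH jn]; first by case: hF => -> _ _ _; rewrite mxE.
by apply: spin_parity (fan_spin hF jn) (IH (ltnW jn)).
Qed.

Lemma fan_part F j : is_fan F -> (j <= n)%N -> is_partition F`_j.
Proof. by move=> [_ _ h _]; apply: h. Qed.

(** The local rule applies at every step of a promotion. *)
Lemma pr_entry_fan F z : is_fan F -> (z < n)%N ->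
  is_partition (pr_entry F z) /\ spin (pr_entry F z) F`_z.+1.
Proof.
move=> hF; elim: z => [n0|z IH zn] /=.
  split; first exact: part0.
  by have := fan_spin hF n0; case: hF => -> _ _ _.
have [pk sk] := IH (ltnW zn); split; first exact: dom_part.
have pl := fan_part hF (ltnW zn); have pn := fan_part hF zn.
have [_ s] := dom_spin pl pn pk (fan_spin hF zn) sk (fan_parity hF (ltnW zn)).
exact: spinC.
Qed.

Lemma pr_fan F : (0 < n)%N -> is_fan F -> is_fan (pr F).
Proof.
move=> n0 hF; split.
- by rewrite nth_pr.
- exact: nth_pr_last.
- move=> i; rewrite leq_eqVlt => /orP[/eqP ->|lt].
    by rewrite nth_pr_last; exact: part0.
  by rewrite nth_pr //; have [] := pr_entry_fan hF lt.
move=> i lt; rewrite (nth_pr _ lt).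
have [pk sk] := pr_entry_fan hF lt.
case: (ltnP i.+1 n) => lt2; last first.
  have e : i.+1 = n by lia.
  by move: sk; rewrite e nth_pr_last; case: hF => _ -> _ _.
rewrite (nth_pr _ lt2) /=.
have pl := fan_part hF lt; have pn := fan_part hF lt2.
by have [] := dom_spin pl pn pk (fan_spin hF lt2) sk (fan_parity hF lt).
Qed.

Lemma cap_vstrip (la mu : 'rV[int]_r) : spin la mu ->
  vstrip (cap la mu) la /\ vstrip (cap la mu) mu.
Proof.
by move=> s; split=> k; move: (spinE k s); rewrite mxE; lia.
Qed.

(** Adjacent labels differ by vertical strips; the induction needs this at every
    cell to apply the results on the Burge rule. *)
Lemma level_inv F k : is_fan F ->
  (forall x, (k + x <= n)%N -> is_partition (level F k x)) /\
  (forall x, (k.+1 + x <= n)%N -> is_partition (level F k.+1 x) /\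
     vstrip (level F k.+1 x) (level F k x) /\
     vstrip (level F k.+1 x) (level F k x.+1)).
Proof.
move=> hF; elim: k => [|k [IHp IHs]].
  split=> x xn; first by apply: fan_part.
  split; first by apply: part_cap; apply: fan_part => //; lia.
  by apply: cap_vstrip; apply: fan_spin => //; lia.
have p1 x : (k.+1 + x <= n)%N -> is_partition (level F k.+1 x).
  by move=> xn; have [] := IHs x xn.
split=> // x xn.
have [pa [_ sa]] := IHs x ltac:(lia).
have [pd [sd _]] := IHs x.+1 ltac:(lia).
have pb := IHp x.+1 ltac:(lia).
split; first exact: (burge_part pa pb pd sa sd).
exact: (burge_vstrip pa pb pd sa sd).
Qed.

Lemma level_part F k x : is_fan F -> (k + x <= n)%N ->
  is_partition (level F k x).
Proof. by move=> hF; have [h _] := level_inv k hF; apply: h. Qed.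

Lemma level_vstripl F k x : is_fan F -> (k.+1 + x <= n)%N ->
  vstrip (level F k.+1 x) (level F k x).
Proof.
by move=> hF xn; have [_ h] := level_inv k hF; have [_ []] := h x xn.
Qed.

Lemma level_vstripr F k x : is_fan F -> (k.+1 + x <= n)%N ->
  vstrip (level F k.+1 x) (level F k x.+1).
Proof.
by move=> hF xn; have [_ h] := level_inv k hF; have [_ []] := h x xn.
Qed.

Lemma level_left F k : is_fan F -> (k <= n)%N -> level F k 0 = 0.
Proof.
move=> hF; elim: k => [_|k IH kn]; first by case: hF.
apply/rowP => j; have [p0 _] := level_part hF (k := k.+1) (x := 0) ltac:(lia).
have := level_vstripl hF (k := k) (x := 0) ltac:(lia) j.
by move: (p0 j); rewrite IH 1?ltnW // !mxE; lia.
Qed.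

Lemma level_bottom F k x : is_fan F -> (k + x = n)%N -> level F k x = 0.
Proof.
move=> hF; elim: k x => [x|k IH x kn].
  by rewrite add0n => ->; case: hF.
apply/rowP => j; have [p0 _] := level_part hF (k := k.+1) (x := x) ltac:(lia).
have := level_vstripr hF (k := k) (x := x) ltac:(lia) j.
by move: (p0 j); rewrite IH ?mxE; lia.
Qed.

Lemma level_octa F k x : is_fan F -> (k.+2 + x <= n)%N ->
  octa (trunc_sum (level F k.+1 x)) (trunc_sum (level F k x.+1))
       (trunc_sum (level F k.+1 x.+1)) (trunc_sum (level F k.+2 x)).
Proof.
move=> hF kn; apply: burge_octa.
- by apply: level_part => //; lia.
- by apply: level_part => //; lia.
- by apply: level_part => //; lia.
- by apply: level_vstripr => //; lia.
- by apply: level_vstripl => //; lia.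
Qed.

Lemma filling_level F k x : is_fan F -> (k.+2 + x <= n)%N ->
  filling F x.+1 (n - (k + x.+1)) =
  weight (level F k x.+1) + weight (level F k.+2 x)
  - weight (level F k.+1 x) - weight (level F k.+1 x.+1).
Proof.
move=> hF kn; rewrite /filling /label /=.
have -> : (n - (x + (n - (k + x.+1))))%N = k.+1 by lia.
have -> : (n - (x.+1 + (n - (k + x.+1))))%N = k by lia.
have -> : (n - (x.+1 + (n - (k + x.+1)).-1))%N = k.+1 by lia.
apply: burge_filling.
- by apply: level_part => //; lia.
- by apply: level_part => //; lia.
- by apply: level_part => //; lia.
- by apply: level_vstripr => //; lia.
- by apply: level_vstripl => //; lia.
Qed.

(** The solution [ga] of the octahedron recurrence with [ga 0 = 0]. *)
Fixpoint octa_solve (al be de : nat -> int) (w : nat) : int :=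
  if w is w'.+1 then
    Num.max (al w + de w) (octa_solve al be de w' + be w.+1) - be w
  else 0.

Lemma octa_solveP al be de : octa al be de (octa_solve al be de).
Proof. by move=> w /=; rewrite subrK. Qed.

(** The middle layer; [middle F k z] is its value at level [k] and abscissa
    [z + 1] in the triangle of [F], which is abscissa [z] in that of [pr F].  On
    the diagonal it comes from the intersection of the two labels. *)
Fixpoint middle F k z : nat -> int :=
  match k with
  | 0 => trunc_sum (cap F`_z.+1 (pr F)`_z)
  | 1 => psum (overlap (odd z.+1) (colht (pr F)`_z) (colht F`_z.+2))
  | (k'.+1 as k1).+1 =>
      octa_solve (middle F k1 z) (middle F k' z.+1) (middle F k1 z.+1)
  end.

(** The entry of index [d > 0] in the first row of the promotion matrix. *)
Definition neg_count F d : nat :=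
  nb_neg ((pr F)`_d.-1 + F`_d.+1 - F`_d).

Section Layers.
Variable F : n.+1.-tuple 'rV[int]_r.
Hypotheses (n0 : (0 < n)%N) (hF : is_fan F).
Let F' := pr F.
Let hF' : is_fan F' := pr_fan n0 hF.
(* A is the triangle of F, A' that of pr F, and D the middle layer. *)
Let A k x := trunc_sum (level F k x).
Let A' k x := trunc_sum (level F' k x).
Let D k z := middle F k z.
Let v d : int := (neg_count F d)%:Z.

Lemma pr_spin z : (z < n)%N -> spin F'`_z F`_z.+1.
Proof. by move=> zn; rewrite nth_pr //; have [] := pr_entry_fan hF zn. Qed.

Lemma middle_at0 k z : (k + z < n)%N -> D k z 0%N = 0.
Proof.
case: k => [|[|k]] zn //; last exact: psum0.
apply: trunc_sum0; apply: part_cap.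
  by apply: fan_part => //; lia.
by apply: (fan_part hF'); lia.
Qed.

(** The links between levels [k] and [k + 1].  In the triangle of [F] the
    vertical edge carries an insertion, of the lost entry of its row; in that of
    [pr F] the horizontal edge does, of the lost entry of its column. *)
Definition linked k z :=
  [/\ slide (D k.+1 z) (A k.+1 z.+1) (D k z.+1) (A k z.+2),
      insertion (A k z.+1) (A k.+1 z.+1) (D k z) (D k.+1 z) (v (k + z.+1)),
      slide (D k.+1 z) (A' k.+1 z) (D k z) (A' k z),
      insertion (A' k z.+1) (A' k.+1 z) (D k z.+1) (D k.+1 z) (v z.+1)
    & nested (D k.+1 z) (D k z) /\ nested (D k.+1 z) (D k z.+1)].

Lemma linked0 z : (z.+2 <= n)%N -> linked 0 z.
Proof.
move=> zn.
have pl : is_partition F`_z.+1 by apply: fan_part => //; lia.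
have pn : is_partition F`_z.+2 by apply: fan_part.
have pk : is_partition F'`_z by apply: fan_part => //; lia.
have sn := fan_spin hF zn.
have sk := pr_spin (ltnW zn).
have hp := fan_parity hF (ltnW zn).
have mE : F'`_z.+1 = dom (F'`_z + F`_z.+2 - F`_z.+1).
  by rewrite !nth_pr //; lia.
have [c1 c2 c3 c4 [c5 c6]] := corner pl pn pk sn sk hp.
by split; [..|split]; rewrite /D /A /A' /v /neg_count /= ?add0n ?mE.
Qed.

Lemma A0 k x : (k + x <= n)%N -> A k x 0%N = 0.
Proof. by move=> kn; apply: trunc_sum0; apply: level_part. Qed.

Lemma A'0 k x : (k + x <= n)%N -> A' k x 0%N = 0.
Proof. by move=> kn; apply: trunc_sum0; apply: level_part. Qed.

Lemma octaC al be de ga : octa al be de ga -> octa de be al ga.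
Proof. by move=> O w; rewrite (O w); lia. Qed.

Lemma linked_all k z : (k + z.+2 <= n)%N -> linked k z.
Proof.
elim: k z => [|k IH] z kn; first by apply: linked0.
have [a1 a2 a3 a4 [a5 a6]] := IH z ltac:(lia).
have [b1 b2 b3 b4 [b5 b6]] := IH z.+1 ltac:(lia).
have OD : octa (D k.+1 z) (D k z.+1) (D k.+1 z.+1) (D k.+2 z).
  exact: octa_solveP.
have OA : octa (A k.+1 z.+1) (A k z.+2) (A k.+1 z.+2) (A k.+2 z.+1).
  by apply: level_octa => //; lia.
have OA' : octa (A' k.+1 z) (A' k z.+1) (A' k.+1 z.+1) (A' k.+2 z).
  by apply: level_octa => //; lia.
have d1 : D k.+2 z 0%N = 0 by [].
have d2 : D k.+1 z 0%N = 0 by apply: middle_at0; lia.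
have d3 : D k z.+1 0%N = 0 by apply: middle_at0; lia.
have d4 : D k.+1 z.+1 0%N = 0 by apply: middle_at0; lia.
have e1 : A k.+2 z.+1 0%N = 0 by apply: A0; lia.
have e2 : A k.+1 z.+2 0%N = 0 by apply: A0; lia.
have f1 : A' k.+2 z 0%N = 0 by apply: A'0; lia.
have f2 : A' k.+1 z 0%N = 0 by apply: A'0; lia.
have [g1 g2] := cube_consistency e1 d1 d2 d3 e2 d4 OA OD a1 b2.
have [h1 h2] := cube_consistency f1 d1 d4 d3 f2 d2 (octaC OA') (octaC OD) b3 a4.
have [i1 i2] := octa_nested d1 d2 d4 d3 a6 b5 OD.
by split=> //; rewrite addSnnS.
Qed.

Lemma middle_stable k z : (k + z < n)%N -> exists s, stable (D k z) s.
Proof.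
elim: k => [|k IH] kn.
  by exists (weight (cap F`_z.+1 F'`_z)); apply: trunc_sum_stable.
have [_ _ _ _ [N _]] := linked_all (k := k) (z := z) ltac:(lia).
have [s st] := IH ltac:(lia).
exact: nested_stable N st.
Qed.

(** The middle layer vanishes on its left side and on its bottom side. *)
Lemma middle_left k : (k < n)%N -> forall w, D k 0 w = 0.
Proof.
elim: k => [|k IH] kn.
  have e : F'`_0 = 0 by rewrite nth_pr.
  by move=> w; rewrite /D /middle e trunc_sum_cap0r //; apply: fan_part.
have [_ _ _ _ [N _]] := linked_all (k := k) (z := 0) ltac:(lia).
by apply: nested_zero N _ (IH _); [apply: middle_at0 |]; lia.
Qed.

Lemma middle_bottom k z : (k + z.+1 = n)%N -> forall w, D k z w = 0.
Proof.
elim: k z => [|k IH] z kn.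
  have e : F`_z.+1 = 0 by move: kn; rewrite add0n => ->; case: hF.
  by move=> w; rewrite /D /middle e trunc_sum_cap0l //; apply: (fan_part hF');
    lia.
have [_ _ _ _ [_ N]] := linked_all (k := k) (z := z) ltac:(lia).
by apply: nested_zero N _ (IH _ _); [apply: middle_at0 |]; lia.
Qed.

(** The cells that the two triangles share have the same filling. *)
Lemma filling_shift k z : (k + z.+3 <= n)%N ->
  filling F z.+2 (n - (k + z.+2)) = filling F' z.+1 (n - (k + z.+1)).
Proof.
move=> kn; rewrite !filling_level //; try lia.
have [a1 _ _ _ _] := linked_all (k := k) (z := z) ltac:(lia).
have [_ _ a3 _ _] := linked_all (k := k) (z := z.+1) ltac:(lia).
have [b1 _ b3 _ _] := linked_all (k := k.+1) (z := z) ltac:(lia).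
have [s1 t1] := middle_stable (k := k) (z := z.+1) ltac:(lia).
have [s2 t2] := middle_stable (k := k.+1) (z := z) ltac:(lia).
have [s3 t3] := middle_stable (k := k.+1) (z := z.+1) ltac:(lia).
have [s4 t4] := middle_stable (k := k.+2) (z := z) ltac:(lia).
have W (x : 'rV[int]_r) := trunc_sum_stable x.
have := stable_slide t2 (W _) t1 (W _) a1.
have := stable_slide t3 (W _) t1 (W _) a3.
have := stable_slide t4 (W _) t3 (W _) b1.
have := stable_slide t4 (W _) t2 (W _) b3; lia.
Qed.

Lemma zero_stable (a : nat -> int) : (forall w, a w = 0) -> stable a 0.
Proof. by move=> h; exists 0%N. Qed.

Lemma weight0 : weight (0 : 'rV[int]_r) = 0.
Proof. by rewrite /weight big1 // => k _; rewrite mxE. Qed.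

(** The column that the triangle of [F] loses. *)
Lemma filling_first_column k : (k.+2 <= n)%N ->
  filling F 1 (n - (k + 1)) = v k.+1.
Proof.
move=> kn; rewrite filling_level //; last by lia.
have [_ a2 _ _ _] := linked_all (k := k) (z := 0) ltac:(lia).
have W (x : 'rV[int]_r) := trunc_sum_stable x.
have z1 := zero_stable (middle_left (k := k) ltac:(lia)).
have z2 := zero_stable (middle_left (k := k.+1) ltac:(lia)).
have := stable_insertion (W _) (W _) z1 z2 a2.
by rewrite addn1 !level_left ?weight0 //; lia.
Qed.

(** The row that the triangle of [pr F] loses. *)
Lemma filling_last_row z : (z.+2 <= n)%N -> filling F' z.+1 1 = v z.+1.
Proof.
move=> zn; set k := (n - z.+2)%N.
have -> : 1%N = (n - (k + z.+1))%N by rewrite /k; lia.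
rewrite filling_level //; last by rewrite /k; lia.
have [_ _ _ a4 _] := linked_all (k := k) (z := z) ltac:(rewrite /k; lia).
have W (x : 'rV[int]_r) := trunc_sum_stable x.
have z1 := zero_stable (middle_bottom (k := k) (z := z.+1)
  ltac:(rewrite /k; lia)).
have z2 := zero_stable (middle_bottom (k := k.+1) (z := z)
  ltac:(rewrite /k; lia)).
have := stable_insertion (W _) (W _) z1 z2 a4.
rewrite [level F' k.+2 z]level_bottom ?[level F' k.+1 z.+1]level_bottom //;
  by rewrite /k; lia.
Qed.
End Layers.

(** * Rotation of the growth matrix *)

(** The entries of the growth matrix, indexed by natural numbers. *)
Definition growth F i j : int :=
  if (j < i)%N then filling F j.+1 (n - i)
  else if (i < j)%N then filling F i.+1 (n - j)
  else 0.

Lemma growthC F i j : growth F i j = growth F j i.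
Proof. by rewrite /growth; case: ltngtP. Qed.

Lemma growth_pr F i j : is_fan F -> (i < n)%N -> (j < n)%N ->
  growth (pr F) i j = growth F (i.+1 %% n) (j.+1 %% n).
Proof.
move=> hF; wlog ij : i j / (j <= i)%N.
  move=> H; case/orP: (leq_total j i) => [/H//|/H h lin ljn].
  by rewrite growthC h // growthC.
move: ij; rewrite leq_eqVlt => /orP[/eqP ->|ij] lin ljn.
  by rewrite /growth !ltnn.
have n0 : (0 < n)%N by lia.
rewrite (modn_small (m := j.+1)); last by lia.
rewrite {1}/growth ij.
case: (ltnP i.+1 n) => lt.
  rewrite modn_small // /growth ltnS ij.
  have := filling_shift n0 hF (k := (i - j.+1)%N) (z := j) ltac:(lia).
  have -> : (n - (i - j.+1 + j.+2) = n - i.+1)%N by lia.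
  by have -> : (n - (i - j.+1 + j.+1) = n - i)%N by lia.
have -> : i = n.-1 by lia.
rewrite prednK // modnn /growth /=.
have -> : (n - n.-1 = 1)%N by lia.
rewrite filling_last_row //; last by lia.
have := filling_first_column n0 hF (k := j) ltac:(lia).
by rewrite addn1.
Qed.

Lemma growth_iter_pr F s i j : is_fan F -> (i < n)%N -> (j < n)%N ->
  growth (iter s (@pr r n) F) i j = growth F ((i + s) %% n) ((j + s) %% n).
Proof.
move=> hF lin ljn; have n0 : (0 < n)%N by lia.
elim: s i j lin ljn => [|s IH] i j lin ljn.
  by rewrite !addn0 !modn_small.
have hs : is_fan (iter s (@pr r n) F).
  by elim: s {IH} => [//|s IH]; apply: pr_fan.
rewrite iterS growth_pr // IH ?ltn_pmod //.
by rewrite !modnDml !addSnnS.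
Qed.
End Fans.

Theorem theorem4p5 (r n : nat) (hr : (0 < r)%N) (hn : (0 < n)%N)
    (F : n.+1.-tuple 'rV[int]_r) (hF : is_fan F) :
  growth_matrix F = promotion_matrix F.
Proof.
apply/matrixP => i j; rewrite !mxE -/(growth F i j).
case: (eqVneq i j) => [->|nij]; first by rewrite /growth !ltnn.
set d := ((j + n - i) %% n)%N.
have nij' : (i : nat) <> j by move=> e; case/eqP: nij; apply: val_inj.
have dn : (d < n)%N by rewrite ltn_pmod.
have dE : ((d + i) %% n = j)%N.
  by rewrite /d modnDml subnK ?modnDr ?modn_small //; move: (ltn_ord i); lia.
have d0 : (0 < d)%N.
  rewrite lt0n; apply/eqP => e; apply: nij'.
  by rewrite -dE e add0n modn_small.
have hs : is_fan (iter i (@pr r n) F).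
  by elim: (nat_of_ord i) => [//|s IH]; apply: pr_fan.
have := growth_iter_pr i hF hn dn; rewrite add0n dE modn_small // => <-.
rewrite /growth d0 /=.
have := filling_first_column hn hs (k := d.-1) ltac:(lia).
by rewrite addn1 prednK // /neg_count.
Qed.
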